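(* Let $\mathscr{Q}$ be a commutative semicartesian quantale. For each idempotent $e$ of $\mathscr{Q}$ let $S_e=\{e\}$ be the one-point $\mathscr{Q}$-set with $\delta(e,e)=e\otimes e=e$. Then the set $\{S_e : e\in\mathscr{Q},\ e\otimes e=e\}$ is a separating family for the category $\mathscr{Q}\text{-}\mathbf{Set}$ of $\mathscr{Q}$-sets and functional morphisms.
   Context: A quantale $\mathscr{Q}=(|\mathscr{Q}|,\leq,\otimes)$ is a complete lattice with an associative binary operation $\otimes$ that distributes over arbitrary suprema (including the empty one) in each variable. It is commutative if $\otimes$ is commutative, and semicartesian if $a\otimes b\leq a\wedge b$ for all $a,b$. A $\mathscr{Q}$-set is a set $X$ with a map $\delta:X\times X\to\mathscr{Q}$ such that for all $x,y,z\in X$: (1) $\delta(x,y)=\delta(y,x)$; (2) $\delta(x,y)\otimes\delta(y,z)\leq\delta(x,z)$; (3) $\delta(x,x)\otimes\delta(x,y)=\delta(x,y)$. The extent of $x$ is $\mathrm{E}x=\delta(x,x)$. A functional morphism $f:X\to Y$ of $\mathscr{Q}$-sets is a function between the underlying sets with $\delta_X(x,x')\leq\delta_Y(f(x),f(x'))$ and $\mathrm{E}f(x)=\mathrm{E}x$ for all $x,x'\in X$. $\mathscr{Q}\text{-}\mathbf{Set}$ is the category of $\mathscr{Q}$-sets and functional morphisms. A set of objects is a separating family if for any two distinct parallel morphisms $f,g:X\to Y$ there is a morphism $s:S\to X$ from some object $S$ of the set with $f\circ s\neq g\circ s$. *)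

(* Defs.v *)
(* Built on MathComp and the classical layer of MathComp-Analysis. *)
From HB Require Import structures.
From mathcomp Require Import all_boot all_order.
From mathcomp Require Import boolp classical_sets.

Set Implicit Arguments.
Unset Strict Implicit.
Unset Printing Implicit Defensive.

Import Order.Theory.
Local Open Scope order_scope.
Local Open Scope classical_set_scope.

(* The lattice is complete by [qsupP]; its bottom, top and binary meet are
   then determined by the order, so starting from [tbLatticeType] only serves
   to reuse the library's notation for them. In the two distributivity laws
   [B] may be empty. *)
HB.mixin Record isQuantale d (Q : Type) of Order.TBLattice d Q := {
  qsup : set Q -> Q;
  qmul : Q -> Q -> Q;
  qsupP : forall A : set Q, supremums A (qsup A);
  qmulA : associative qmul;
  qmul_supr : forall (a : Q) (B : set Q),
    qmul a (qsup B) = qsup [set qmul a b | b in B];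
  qmul_supl : forall (a : Q) (B : set Q),
    qmul (qsup B) a = qsup [set qmul b a | b in B]
}.

#[short(type="quantaleType")]
HB.structure Definition Quantale d :=
  { Q of Order.TBLattice d Q & isQuantale d Q }.

Declare Scope quantale_scope.
Delimit Scope quantale_scope with QT.
Notation "a ⊗ b" := (qmul a b) (at level 40, left associativity)
  : quantale_scope.
Local Open Scope quantale_scope.

Definition commutative_quantale d (Q : quantaleType d) : Prop :=
  forall a b : Q, a ⊗ b = b ⊗ a.

Definition semicartesian d (Q : quantaleType d) : Prop :=
  forall a b : Q, (a ⊗ b <= a `&` b)%O.

(* Morphisms are compared with Leibniz equality. *)
Record category := Category {
  cat_obj :> Type;
  cat_hom : cat_obj -> cat_obj -> Type;
  cat_id : forall X, cat_hom X X;
  cat_comp : forall X Y Z, cat_hom Y Z -> cat_hom X Y -> cat_hom X Z;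
  cat_comp1m : forall X Y (f : cat_hom X Y), cat_comp (cat_id Y) f = f;
  cat_compm1 : forall X Y (f : cat_hom X Y), cat_comp f (cat_id X) = f;
  cat_compA : forall X Y Z W (h : cat_hom Z W) (g : cat_hom Y Z) (f : cat_hom X Y),
    cat_comp h (cat_comp g f) = cat_comp (cat_comp h g) f
}.

(* [F] is a plain predicate: with [F : set C], the type of objects would have
   to fit in the universe of [set_type], which is used below for carriers. *)
Definition separating_family (C : category) (F : C -> Prop) : Prop :=
  forall (X Y : C) (f g : cat_hom X Y), f <> g ->
    exists2 S : C, F S & exists s : cat_hom S X, cat_comp f s <> cat_comp g s.

Arguments separating_family : clear implicits.

Section QSets.
Context d (Q : quantaleType d).

Record qset := QSet {
  qcarrier :> Type;
  delta : qcarrier -> qcarrier -> Q;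
  deltaC : forall x y, delta x y = delta y x;
  delta_trans : forall x y z, delta x y ⊗ delta y z <= delta x z;
  delta_extent : forall x y, delta x x ⊗ delta x y = delta x y
}.

Definition extent (X : qset) (x : X) : Q := delta x x.

Record functional_morphism (X Y : qset) := FunctionalMorphism {
  fmap :> X -> Y;
  fmap_delta : forall x x' : X, delta x x' <= delta (fmap x) (fmap x');
  fmap_extent : forall x : X, extent (fmap x) = extent x
}.

Lemma functional_morphism_eq (X Y : qset) (f g : functional_morphism X Y) :
  f =1 g -> f = g.
Proof.
case: f g => [f df ef] [g dg eg] /= /funext fg; subst g.
by congr FunctionalMorphism; apply: Prop_irrelevance.
Qed.

Definition fm_id (X : qset) : functional_morphism X X :=
  @FunctionalMorphism X X id (fun _ _ => lexx _) (fun _ => erefl).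

Lemma fm_comp_delta (X Y Z : qset) (g : functional_morphism Y Z)
    (f : functional_morphism X Y) (x x' : X) :
  delta x x' <= delta (g (f x)) (g (f x')).
Proof. exact: le_trans (fmap_delta f x x') (fmap_delta g (f x) (f x')). Qed.

Lemma fm_comp_extent (X Y Z : qset) (g : functional_morphism Y Z)
    (f : functional_morphism X Y) (x : X) :
  extent (g (f x)) = extent x.
Proof. by rewrite !fmap_extent. Qed.

Definition fm_comp (X Y Z : qset) (g : functional_morphism Y Z)
    (f : functional_morphism X Y) : functional_morphism X Z :=
  @FunctionalMorphism X Z (g \o f) (fm_comp_delta g f) (fm_comp_extent g f).

Lemma fm_comp1m (X Y : qset) (f : functional_morphism X Y) :
  fm_comp (fm_id Y) f = f.
Proof. exact: functional_morphism_eq. Qed.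

Lemma fm_compm1 (X Y : qset) (f : functional_morphism X Y) :
  fm_comp f (fm_id X) = f.
Proof. exact: functional_morphism_eq. Qed.

Lemma fm_compA (X Y Z W : qset) (h : functional_morphism Z W)
    (g : functional_morphism Y Z) (f : functional_morphism X Y) :
  fm_comp h (fm_comp g f) = fm_comp (fm_comp h g) f.
Proof. exact: functional_morphism_eq. Qed.

Definition QSetCat : category :=
  @Category qset functional_morphism fm_id fm_comp
    fm_comp1m fm_compm1 fm_compA.

Section Singleton.
Variables (e : Q) (he : e ⊗ e = e).

Definition singleton_delta (x y : set_type [set e]) : Q := val x ⊗ val y.

Lemma singleton_deltaE x y : singleton_delta x y = e.
Proof.
by rewrite /singleton_delta (set_mem (valP x)) (set_mem (valP y)) he.
Qed.

Lemma singleton_deltaC x y : singleton_delta x y = singleton_delta y x.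
Proof. by rewrite !singleton_deltaE. Qed.

Lemma singleton_delta_trans x y z :
  singleton_delta x y ⊗ singleton_delta y z <= singleton_delta x z.
Proof. by rewrite !singleton_deltaE he. Qed.

Lemma singleton_delta_extent x y :
  singleton_delta x x ⊗ singleton_delta x y = singleton_delta x y.
Proof. by rewrite !singleton_deltaE he. Qed.

Definition singleton_qset : qset :=
  @QSet (set_type [set e]) singleton_delta
    singleton_deltaC singleton_delta_trans singleton_delta_extent.

End Singleton.

Definition singleton_qsets : QSetCat -> Prop := fun S =>
  exists (e : Q) (he : e ⊗ e = e), S = singleton_qset he.

End QSets.

Arguments singleton_qsets {d} Q _.

(* Main.v *)
Require Import Defs.
From mathcomp Require Import all_boot all_order.
From mathcomp Require Import boolp classical_sets.

(** By the third axiom of a Q-set the extent of every point [x] is idempotent,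
    so [x] is the image of a morphism into [X] from the one-point Q-set whose
    point is that extent. Distinct parallel morphisms differ at some point
    [x], and precomposing with the morphism picking [x] keeps them distinct. *)

Lemma extent_idem {d : Order.disp_t} {Q : quantaleType d} {X : qset Q} (x : X) :
  qmul (extent x) (extent x) = extent x.
Proof. exact: delta_extent. Qed.

(** The morphism from the one-point Q-set on the extent of [x] that picks
    [x]. *)
Definition point_morphism {d : Order.disp_t} {Q : quantaleType d}
    {X : qset Q} (x : X) :
  functional_morphism (singleton_qset (extent_idem x)) X.
Proof.
apply: (@FunctionalMorphism _ _ (singleton_qset (extent_idem x)) X (fun=> x)).
- by move=> a b; rewrite /= singleton_deltaE //; exact: extent_idem.
- by move=> a; rewrite [RHS]singleton_deltaE //; exact: extent_idem.
Defined.

Theorem mainTheorem1 (d : Order.disp_t) (Q : quantaleType d)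
    (Qcomm : commutative_quantale Q) (Qsemi : semicartesian Q) :
  separating_family (QSetCat Q) (singleton_qsets Q).
Proof.
move=> X Y f g fg.
have [x fgx] : exists x, fmap f x <> fmap g x.
  apply: contrapT => /forallNP fgE; apply: fg.
  by apply: functional_morphism_eq => x; exact: contrapT (fgE x).
exists (singleton_qset (extent_idem x)).
  by exists (extent x), (extent_idem x).
exists (point_morphism x) => fgs; apply: fgx.
pose pt : singleton_qset (extent_idem x) :=
  exist _ (extent x) (mem_set (erefl (extent x))).
exact: (congr1 (fun h : functional_morphism _ Y => fmap h pt) fgs).
Qed.
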